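(* Let $G=(V,E,\omega)\in\mathcal{G}$ and let $f_0^+:\mathcal{V}\to\mathbb{R}\cup\{+\infty\}$ be defined by $$f_0^+(u):=\begin{cases}\sum_{i,j\in V}\omega_{ij}|u_i+u_j|,&\text{if }u\in\mathcal{V}^b,\\ +\infty,&\text{if }u\in\mathcal{V}\setminus\mathcal{V}^b.\end{cases}$$ For every $u\in\mathcal{V}^b$, let $C_u\in\mathcal{C}$ be the cut induced by $u$. Then, for all $u\in\mathcal{V}$, $$f_0^+(u)=\begin{cases}2\sum_{i,j\in V}\omega_{ij}-4s(C_u),&\text{if }u\in\mathcal{V}^b,\\ +\infty,&\text{if }u\in\mathcal{V}\setminus\mathcal{V}^b.\end{cases}$$ In particular, if $u^*\in\operatorname{argmin}_{u\in\mathcal{V}}f_0^+(u)$, then $u^*\in\mathcal{V}^b$ and $C_{u^*}$ is a maximum cut of $G$.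
   Context: $\mathcal{G}$ denotes the set of non-empty finite, simple (no self-loops, no multiple edges), undirected, edge-weighted graphs $G=(V,E,\omega)$ without isolated nodes, with $V=\{1,\dots,n\}$. The edge weights satisfy $\omega_{ij}=\omega_{ji}>0$ if $(i,j)\in E$, and $\omega$ is extended to $V^2$ by $\omega_{ij}=0$ if $(i,j)\notin E$ (in particular $\omega_{ii}=0$). $\mathcal{V}$ is the set of all functions $u:V\to\mathbb{R}$ (write $u_i:=u(i)$). $\mathcal{V}^b:=\{u\in\mathcal{V}:\forall i\in V,\ u_i\in\{-1,1\}\}$. For $u\in\mathcal{V}^b$ the cut induced by $u$ is the partition $C_u=V_{-1}|V_1$ with $V_{k}:=\{i\in V:u_i=k\}$ for $k\in\{-1,1\}$ (one of the two sets may be empty); $\mathcal{C}$ is the set of all cuts induced by functions in $\mathcal{V}^b$. The size of a cut $C=V_{-1}|V_1$ is $s(C):=\sum_{i\in V_{-1},\,j\in V_1}\omega_{ij}$. A maximum cut of $G$ is a cut $C^*\in\mathcal{C}$ such that $s(C)\leq s(C^* )$ for all $C\in\mathcal{C}$. *)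

(* Defs.v *)
From mathcomp Require Import all_boot all_order all_algebra.
From mathcomp Require Import boolp classical_sets reals constructive_ereal.

Set Implicit Arguments.
Unset Strict Implicit.
Unset Printing Implicit Defensive.

Import Order.TTheory GRing.Theory Num.Theory.

Local Open Scope classical_set_scope.
Local Open Scope ring_scope.

(* Non-empty finite simple undirected graphs with positive edge weights and no
   isolated nodes; [weight] is already extended by 0 outside the edges. *)
Record wgraph (R : realType) := WGraph {
  nnodes : nat;
  edge : rel 'I_nnodes;
  weight : 'I_nnodes -> 'I_nnodes -> R;
  nnodes_gt0 : (0 < nnodes)%N;
  edge_sym : symmetric edge;
  edge_irrefl : irreflexive edge;
  no_isolated : forall i, exists j, edge i j;
  weight_sym : forall i j, weight i j = weight j i;
  weight_gt0 : forall i j, edge i j -> 0 < weight i j;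
  weight_eq0 : forall i j, ~~ edge i j -> weight i j = 0
}.

Section Cuts.
Variables (R : realType) (G : wgraph R).

Definition node : finType := 'I_(nnodes G).

Definition nodefun : Type := node -> R.

Definition binary : set nodefun := [set u | forall i, u i = -1 \/ u i = 1].

(* The partition V_{-1}|V_1 as the pair (V_{-1}, V_1). Either set may be empty. *)
Definition cut : Type := ({set node} * {set node})%type.

(* Meaningful for [u] in [binary]. *)
Definition cut_of (u : nodefun) : cut :=
  ([set i | u i == -1]%SET, [set i | u i == 1]%SET).

Definition cuts : set cut := cut_of @` binary.

Definition cut_size (C : cut) : R :=
  \sum_(i in C.1) \sum_(j in C.2) weight i j.

Definition max_cut (C : cut) : Prop :=
  cuts C /\ forall C', cuts C' -> cut_size C' <= cut_size C.

Definition f0plus (u : nodefun) : \bar R :=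
  if u \in binary
  then (\sum_(i : node) \sum_(j : node) weight i j * `|u i + u j|)%:E
  else +oo%E.

End Cuts.

Arguments binary {R} G.
Arguments cuts {R} G.
Arguments f0plus {R} G.

Definition argmin (R : realType) (T : Type) (f : T -> \bar R) : set T :=
  [set x | forall y, (f x <= f y)%E].

(* Main.v *)
Require Import Defs.
From mathcomp Require Import all_boot all_order all_algebra.
From mathcomp Require Import boolp classical_sets reals constructive_ereal.
From mathcomp Require Import ring lra.

(** For two values [a], [b] in {-1, 1}, the number [`|a + b|] is 2 when they
    agree and 0 when they differ. The energy thus counts every ordered pair of
    nodes with weight [2 * weight i j], except the pairs separated by the cut.
    A separated pair is met twice in the double sum, once in each order, and by
    symmetry of the weights each order contributes [cut_size (cut_of u)]; the
    total defect is therefore [4 * cut_size (cut_of u)] ([energy_cut_size]).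

    On binary functions the energy is hence a constant minus a positive multiple
    of the cut size, so minimizing the former maximizes the latter. A minimizer
    over all functions is binary because some binary function, for instance a
    constant one, has finite energy. *)

Import Order.TTheory GRing.Theory Num.Theory.

Local Open Scope classical_set_scope.
Local Open Scope ring_scope.

Lemma normD_binary (R : realType) (a b : R) :
  a = -1 \/ a = 1 -> b = -1 \/ b = 1 ->
  `|a + b| = 2 - 2 * ((a == -1) && (b == 1))%:R
               - 2 * ((b == -1) && (a == 1))%:R.
Proof.
have neN1 : (1 == -1 :> R) = false by apply/eqP; lra.
have N1ne : (-1 == 1 :> R) = false by apply/eqP; lra.
have norm2 : `|1 + 1 : R| = 2 by rewrite ger0_norm; lra.
have normN2 : `|-1 + -1 : R| = 2 by rewrite ler0_norm; lra.
by case=> ->; case=> ->; rewrite ?eqxx ?neN1 ?N1ne /= ?norm2 ?normN2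
  ?addNr ?subrr ?normr0; lra.
Qed.

(** The cut size as a sum over all ordered pairs of nodes: in this form it can
    be combined term by term with the energy. *)
Lemma cut_size_indicator (R : realType) (G : wgraph R) (u : nodefun G) :
  cut_size (cut_of u) =
  \sum_(i : node G) \sum_(j : node G)
     weight i j * ((u i == -1) && (u j == 1))%:R.
Proof.
rewrite /cut_size /= big_mkcond; apply: eq_bigr => i _.
rewrite inE; case: (u i == -1); last by rewrite big1 // => j _; rewrite mulr0.
rewrite big_mkcond; apply: eq_bigr => j _.
by rewrite inE; case: (u j == 1); rewrite ?mulr1 ?mulr0.
Qed.

Lemma energy_cut_size (R : realType) (G : wgraph R) (u : nodefun G) :
  binary G u ->
  \sum_(i : node G) \sum_(j : node G) weight i j * `|u i + u j| =
  2 * (\sum_(i : node G) \sum_(j : node G) weight i j)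
  - 4 * cut_size (cut_of u).
Proof.
move=> bu.
have swap : cut_size (cut_of u) =
    \sum_(i : node G) \sum_(j : node G)
       weight i j * ((u j == -1) && (u i == 1))%:R.
  rewrite cut_size_indicator exchange_big /=.
  by do 2![apply: eq_bigr => ? _]; rewrite weight_sym.
(* One copy of the cut size for each order of the separated pairs. *)
have -> : 4 * cut_size (cut_of u) =
    2 * cut_size (cut_of u) + 2 * cut_size (cut_of u) by ring.
rewrite {1}cut_size_indicator swap opprD addrA !mulr_sumr -!sumrB.
apply: eq_bigr => i _; rewrite !mulr_sumr -!sumrB.
by apply: eq_bigr => j _; rewrite normD_binary //; ring.
Qed.

Lemma f0plus_cut_size (R : realType) (G : wgraph R) (u : nodefun G) :
  f0plus G u =
    if u \in binary G
    then (2 * (\sum_(i : node G) \sum_(j : node G) weight i j)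
          - 4 * cut_size (cut_of u))%:E
    else +oo%E.
Proof.
by rewrite /f0plus; case: ifPn => // /set_mem bu; rewrite energy_cut_size.
Qed.

Lemma argmin_f0plus_binary (R : realType) (G : wgraph R) (u : nodefun G) :
  argmin (f0plus G) u -> binary G u.
Proof.
have b1 : binary G (fun=> 1) by move=> i; right.
move=> /(_ (fun=> 1)); rewrite /f0plus (mem_set b1).
by case: ifPn => [/set_mem //|_]; rewrite leye_eq.
Qed.

Theorem lemma4p1 (R : realType) (G : wgraph R) :
  (forall u : nodefun G,
     f0plus G u =
       if u \in binary G
       then (2 * (\sum_(i : node G) \sum_(j : node G) weight i j)
             - 4 * cut_size (cut_of u))%:E
       else +oo%E) /\
  (forall u : nodefun G,
     argmin (f0plus G) u -> binary G u /\ max_cut (cut_of u)).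
Proof.
split=> [u|u umin]; first exact: f0plus_cut_size.
have bu := argmin_f0plus_binary _ _ _ umin.
split=> //; split; first by exists u.
move=> _ [v bv <-].
have := umin v; rewrite !f0plus_cut_size (mem_set bu) (mem_set bv) lee_fin.
lra.
Qed.
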